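(* Let $\alpha>0$ and $0<\beta<1$. Let $(Z_\alpha(t),t\ge0)$ be the extremal Fréchet process with tail index $\alpha$ and scale $1$, and let $Z_{\alpha,\beta}(t)=Z_\alpha(t^\beta)$, $t\ge0$. Then the process $(Z_{\alpha,\beta}(t),t\ge0)$ is self-similar with exponent $H=\beta/\alpha$ and has stationary max-increments.
   Context: For $\alpha,\sigma>0$ the Fréchet law $F_{\alpha,\sigma}$ has distribution function $\exp\{-\sigma^\alpha x^{-\alpha}\}$, $x>0$ (for $\sigma=0$ it is the point mass at $0$). The extremal Fréchet process $(Z_\alpha(t),t\ge0)$ with scale $1$ is the process such that for all $n$ and $0\le t_1<\cdots<t_n$, $(Z_\alpha(t_1),\ldots,Z_\alpha(t_n))$ has the same law as $\bigl(X^{(1)},\max(X^{(1)},X^{(2)}),\ldots,\max(X^{(1)},\ldots,X^{(n)})\bigr)$, where $X^{(1)},\ldots,X^{(n)}$ are independent, $X^{(1)}$ has law $F_{\alpha,t_1^{1/\alpha}}$, and $X^{(k)}$ has law $F_{\alpha,(t_k-t_{k-1})^{1/\alpha}}$ for $k\ge2$. A process $(Y(t),t\ge0)$ is self-similar with exponent $H$ if for every $c>0$, $(Y(ct),t\ge0)\stackrel{d}{=}(c^HY(t),t\ge0)$ in the sense of equality of finite-dimensional distributions. A process $(Y(t),t\ge0)$ has stationary max-increments if for every $r\ge0$ there exists, perhaps on an enlarged probability space, a stochastic process $(Y^{(r)}(t),t\ge0)$ such that $(Y^{(r)}(t),t\ge0)\stackrel{d}{=}(Y(t),t\ge0)$ and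 $(Y(t+r),t\ge0)\stackrel{d}{=}(Y(r)\vee Y^{(r)}(t),t\ge0)$ (equalities of finite-dimensional distributions). *)

(* Defs.v *)
From HB Require Import structures.
From mathcomp Require Import all_boot all_order all_algebra.
From mathcomp Require Import all_classical all_reals all_analysis.

Set Implicit Arguments.
Unset Strict Implicit.
Unset Printing Implicit Defensive.

Import Order.TTheory GRing.Theory Num.Theory.
Import numFieldNormedType.Exports.

Local Open Scope classical_set_scope.
Local Open Scope ring_scope.

(* Equality of set functions on the measurable sets only: the values that the
   library gives to a pushforward outside the sigma-algebra are irrelevant. *)
Definition eq_law d (T : measurableType d) (R : realType)
    (mu nu : set T -> \bar R) : Prop :=
  forall A : set T, measurable A -> mu A = nu A.

Definition joint_law d (T : measurableType d) (R : realType)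
    (P : probability T R) (n : nat) (X : 'I_n -> T -> R) :
    set (n.-tuple R) -> \bar R :=
  pushforward P (fun w => [tuple X i w | i < n]).

(* A process (Y(t), t >= 0) is a family indexed by the whole of R whose members
   at negative times are never looked at. *)
Definition fdd_eq d (T : measurableType d) d' (T' : measurableType d')
    (R : realType) (P : probability T R) (Y : R -> T -> R)
    (P' : probability T' R) (Y' : R -> T' -> R) : Prop :=
  forall (n : nat) (t : 'I_n -> R), (forall i, 0 <= t i) ->
    eq_law (joint_law P (fun i => Y (t i))) (joint_law P' (fun i => Y' (t i))).

(* Subfamilies are covered by taking A i = setT. *)
Definition independent_RVs d (T : measurableType d) (R : realType)
    (P : probability T R) (n : nat) (X : 'I_n -> {RV P >-> R}) : Prop :=
  forall A : 'I_n -> set R, (forall i, measurable (A i)) ->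
    P (\bigcap_(i in [set: 'I_n]) (X i @^-1` A i)) =
      (\prod_(i < n) P (X i @^-1` A i))%E.

Definition has_frechet_law d (T : measurableType d) (R : realType)
    (P : probability T R) (X : {RV P >-> R}) (alpha sigma : R) : Prop :=
  if sigma == 0 then eq_law (distribution P X) \d_(0 : R)
  else forall x : R, cdf X x =
    (if 0 < x then expR (- (sigma `^ alpha * x `^ (- alpha))) else 0)%:E.

Definition time_increment (R : realType) (t : nat -> R) (k : nat) : R :=
  if k is j.+1 then t j.+1 - t j else t 0%N.

(* Only t 0, ..., t n matter. The index ord0 satisfies the range condition, so
   the default value of the iterated maximum adds nothing to it. *)
Definition extremal_frechet d (T : measurableType d) (R : realType)
    (P : probability T R) (alpha : R) (Z : R -> {RV P >-> R}) : Prop :=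
  forall (n : nat) (t : nat -> R),
    0 <= t 0%N -> (forall k : nat, (k < n)%N -> t k < t k.+1) ->
  exists (d' : measure_display) (T' : measurableType d')
      (Q : probability T' R) (X : 'I_n.+1 -> {RV Q >-> R}),
    [/\ independent_RVs X,
        forall k : 'I_n.+1,
          has_frechet_law (X k) alpha (time_increment t k `^ alpha^-1) &
        eq_law (joint_law P (fun i : 'I_n.+1 => Z (t i)))
          (joint_law Q (fun (i : 'I_n.+1) w =>
             \big[Num.max/X ord0 w]_(j < n.+1 | (j <= i)%N) X j w))].

Definition self_similar d (T : measurableType d) (R : realType)
    (P : probability T R) (H : R) (Y : R -> {RV P >-> R}) : Prop :=
  forall c : R, 0 < c ->
    fdd_eq P (fun t => Y (c * t)) P (fun t w => c `^ H * Y t w).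

(* An enlargement of (T, P) is a probability space (T', P') with a
   measure-preserving map p : T' -> T; a random variable X on T becomes X \o p. *)
Definition stationary_max_increments d (T : measurableType d) (R : realType)
    (P : probability T R) (Y : R -> {RV P >-> R}) : Prop :=
  forall r : R, 0 <= r ->
  exists (d' : measure_display) (T' : measurableType d')
      (P' : probability T' R) (p : {mfun T' >-> T})
      (Yr : R -> {RV P' >-> R}),
    [/\ eq_law (distribution P' p) P,
        fdd_eq P' Yr P Y &
        fdd_eq P (fun t => Y (t + r))
          P' (fun t w => Num.max (Y r (p w)) (Yr t w))].

(* Main.v *)
Require Import Defs.
From HB Require Import structures.
From mathcomp Require Import all_boot all_order all_algebra.
From mathcomp Require Import all_classical all_reals all_analysis.
From mathcomp Require Import measurable_realfun ring lra.

Set Implicit Arguments.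
Unset Strict Implicit.
Unset Printing Implicit Defensive.

Import Order.TTheory GRing.Theory Num.Theory.
Import numFieldNormedType.Exports.

Local Open Scope classical_set_scope.
Local Open Scope ring_scope.

(* If [f] is nondecreasing, then [- ln P(Z (f t_i) <= x_i for all i)] equals
   [f 0 * M 0 + \int M df] with [M b := max {x_i ^ (- alpha) | b <= t_i}]: it is
   additive in the time change [f], and multiplying [f] by [c] amounts to
   rescaling the levels [x_i], whence self-similarity.  For the stationarity of
   the max-increments write
     [t ^ beta = rho t + delta t],  [delta t = (t + r) ^ beta - r ^ beta].
   As [beta <= 1], [rho] is nondecreasing, and [rho t <= r ^ beta].  With [Z'] an
   independent copy of [Z], let [Y^(r) t := max (Z (rho t)) (Z' (delta t))].
   By additivity it has the law of [Z (t ^ beta)]; and since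
   [Z (rho t) <= Z (r ^ beta)] almost surely,
   [max (Z (r ^ beta)) (Y^(r) t) = max (Z (r ^ beta)) (Z' (delta t))], which has
   the law of [Z ((t + r) ^ beta)] by additivity again. *)

(** * Lower events and lower orthants *)

(** The constraints form a list of pairs (index, threshold) in which an index may be absent or
    repeated. Intersection is then concatenation, and indices can be mapped to times that coincide
    or come unsorted. *)
Definition lower_event (R : realType) (T I : Type) (X : I -> T -> R)
    (s : seq (I * R)) : set T :=
  [set w | all (fun p => X p.1 w <= p.2) s].

Lemma lower_event_cons (R : realType) (T I : Type) (X : I -> T -> R) p s :
  lower_event X (p :: s) = X p.1 @^-1` `]-oo, p.2] `&` lower_event X s.
Proof.
apply/seteqP; split => w; rewrite /lower_event /= in_itv /=; first by move/andP.
by move=> [wp ws]; apply/andP.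
Qed.

Lemma lower_event_reindex (R : realType) (T I J : Type) (X : I -> T -> R)
    (g : J -> I) s :
  lower_event (fun j => X (g j)) s = lower_event X [seq (g p.1, p.2) | p <- s].
Proof. by apply/seteqP; split => w; rewrite /lower_event /= all_map. Qed.

Lemma measurable_lower_event d (T : measurableType d) (R : realType) (I : Type)
    (X : I -> T -> R) s :
  (forall i, measurable_fun [set: T] (X i)) -> measurable (lower_event X s).
Proof.
move=> mX; elim: s => [|p s IHs].
  by rewrite (_ : lower_event _ _ = setT)//; apply/seteqP; split.
rewrite lower_event_cons; apply: measurableI => //.
by rewrite -[X in measurable X]setTI; exact: mX.
Qed.

Definition lower_orthant (R : realType) n (s : seq ('I_n * R)) :
    set (n.-tuple R) :=
  lower_event (fun i z => tnth z i) s.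

Lemma measurable_lower_orthant (R : realType) n (s : seq ('I_n * R)) :
  measurable (lower_orthant s).
Proof. by apply: measurable_lower_event => i; exact: measurable_tnth. Qed.

(** The identity is measurable from the sigma-algebra generated by the orthants, because the
    preimage of a ray []x, +oo[] under a coordinate is the complement of an orthant with a single
    constraint. *)
Lemma lower_orthant_generates (R : realType) n (A : set (n.-tuple R)) :
  measurable A -> <<s range (@lower_orthant R n) >> A.
Proof.
move=> mA.
pose G := g_sigma_algebraType (range (@lower_orthant R n)).
have mid : measurable_fun [set: G] (fun z : G => z : n.-tuple R).
  apply/measurable_fun_tnthP => i.
  apply: (measurability _ (RGenOInfty.measurableE R)) => _ [_ [x ->] <-].
  rewrite setTI -[X in measurable X]setCK; apply: measurableC.
  apply: sub_sigma_algebra; exists [:: (i, x)] => //.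
  apply/seteqP; split => z /=; rewrite in_itv /= ?andbT.
    by rewrite /lower_orthant /lower_event /= andbT => zx; apply/negP; rewrite -leNgt.
  by move/negP; rewrite -leNgt /lower_orthant /lower_event /= andbT.
by have := mid measurableT _ mA; rewrite setTI.
Qed.

(** * Joint laws are determined by lower orthants *)

Section joint_law.
Context d (T : measurableType d) (R : realType) (P : probability T R).
Variables (n : nat) (X : 'I_n -> {RV P >-> R}).

(** Bundled below as a measurable function, so that its [distribution] is a measure, whereas
    [joint_law] is a bare set function. *)
Definition random_vector (w : T) : n.-tuple R := [tuple X i w | i < n].

Lemma measurable_random_vector : measurable_fun [set: T] random_vector.
Proof.
apply/measurable_fun_tnthP => i.
rewrite (_ : _ \o _ = X i)//; apply/funext => w /=.
by rewrite tnth_mktuple.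
Qed.

HB.instance Definition _ := @isMeasurableFun.Build _ _ _ _
  random_vector measurable_random_vector.

Lemma joint_law_lower_orthant s :
  joint_law P (fun i => X i) (lower_orthant s) = P (lower_event (fun i => X i) s).
Proof.
congr (P _); apply/seteqP; split=> w /allP h; apply/allP => p /h;
  by rewrite tnth_mktuple.
Qed.

End joint_law.

(** Uniqueness of measures on a pi-system: orthants are stable under intersection by concatenating
    lists, and the empty list gives the whole space. *)
Lemma joint_law_ext d (T : measurableType d) d' (T' : measurableType d')
    (R : realType) (P : probability T R) (P' : probability T' R)
    n (X : 'I_n -> {RV P >-> R}) (X' : 'I_n -> {RV P' >-> R}) :
  (forall s : seq ('I_n * R),
     P (lower_event (fun i => X i) s) = P' (lower_event (fun i => X' i) s)) ->
  eq_law (joint_law P (fun i => X i)) (joint_law P' (fun i => X' i)).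
Proof.
move=> PP' A mA.
pose m := distribution P (random_vector X).
pose m' := distribution P' (random_vector X').
apply: (@g_sigma_algebra_measure_unique _ R _ (range (@lower_orthant R n)) _
  (fun=> setT) _ _ m m').
- by move=> _ [s _ <-]; exact: measurable_lower_orthant.
- by move=> _; exists [::] => //; apply/seteqP; split.
- by apply/seteqP; split => // z _; exists 0%N.
- move=> _ _ [s _ <-] [s' _ <-]; exists (s ++ s') => //.
  apply/seteqP; split => z /=; rewrite /lower_orthant /lower_event /= all_cat.
    by move/andP.
  by move=> [zs zs']; apply/andP.
- move=> _ [s _ <-].
  exact: etrans (joint_law_lower_orthant X s)
    (etrans (PP' s) (esym (joint_law_lower_orthant X' s))).
- by move=> _; rewrite (le_lt_trans (probability_le1 _ _)) ?ltry.
- exact: lower_orthant_generates.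
Qed.

(** * Reduction to positive thresholds *)

Section right_continuity.
Context d (T : measurableType d) (R : realType) (P : probability T R).
Variables (n : nat) (X : 'I_n -> {RV P >-> R}).
Implicit Types s : seq ('I_n * R).

(** Continuity from above: the events with thresholds raised by [1 / (k + 1)] decrease to the event
    itself. *)
Lemma lower_event_right_cvg s :
  P (lower_event (fun i => X i) [seq (p.1, p.2 + k.+1%:R^-1) | p <- s])
    @[k --> \oo] --> P (lower_event (fun i => X i) s).
Proof.
pose F k := lower_event (fun i => X i) [seq (p.1, p.2 + k.+1%:R^-1) | p <- s].
have capF : \bigcap_k F k = lower_event (fun i => X i) s.
  apply/seteqP; split => w.
    move=> Fw; apply/allP => p ps; apply/ler_addgt0Pr => e e0.
    have [k ke] : exists k, k.+1%:R^-1 < e.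
      by have [k _ /(_ _ (leqnn k))] := near_infty_natSinv_lt (PosNum e0); exists k.
    have /allP/(_ (p.1, p.2 + k.+1%:R^-1)) := Fw k I.
    move=> /(_ (map_f _ ps)) /= /le_trans; apply.
    by rewrite lerD2l ltW.
  move=> /allP sw k _; apply/allP => _ /mapP[p ps ->] /=.
  by rewrite (le_trans (sw p ps))// lerDl.
rewrite -capF; apply: nonincreasing_cvg_mu.
- by rewrite (le_lt_trans (probability_le1 _ _)) ?ltry//; exact: measurable_lower_event.
- by move=> k; exact: measurable_lower_event.
- by rewrite capF; exact: measurable_lower_event.
- move=> k l kl; apply/subsetPset => w /allP Fw; apply/allP => _ /mapP[p ps ->].
  have := Fw _ (map_f (fun p => (p.1, p.2 + l.+1%:R^-1)) ps) => /= /le_trans; apply.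
  by rewrite lerD2l lef_pV2 ?posrE// ler_nat ltnS.
Qed.

End right_continuity.

(* Fréchet laws put no mass on the negative half-line, so thresholds [<= 0] are
   either null or reached as decreasing limits of positive ones. *)
Lemma joint_law_ext_ge0 d (T : measurableType d) d' (T' : measurableType d')
    (R : realType) (P : probability T R) (P' : probability T' R)
    n (X : 'I_n -> {RV P >-> R}) (X' : 'I_n -> {RV P' >-> R}) :
  (forall i, P [set w | X i w < 0] = 0%E) ->
  (forall i, P' [set w | X' i w < 0] = 0%E) ->
  (forall s : seq ('I_n * R), all (fun p => 0 < p.2) s ->
     P (lower_event (fun i => X i) s) = P' (lower_event (fun i => X' i) s)) ->
  eq_law (joint_law P (fun i => X i)) (joint_law P' (fun i => X' i)).
Proof.
have null d0 (T0 : measurableType d0) (P0 : probability T0 R)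
    (X0 : 'I_n -> {RV P0 >-> R}) (s : seq ('I_n * R)) :
    (forall i, P0 [set w | X0 i w < 0] = 0%E) ->
    ~~ all (fun p => 0 <= p.2) s -> P0 (lower_event (fun i => X0 i) s) = 0%E.
  move=> X0ge0 /allPn[p ps]; rewrite -ltNge => p0.
  apply/eqP; rewrite eq_le measure_ge0 andbT -(X0ge0 p.1).
  apply: le_measure; rewrite ?inE.
  - exact: measurable_lower_event.
  - rewrite (_ : [set w | _] = X0 p.1 @^-1` `]-oo, 0[); first exact: measurable_funPTI.
    by apply/seteqP; split => w /=; rewrite in_itv.
  - by move=> w /allP/(_ p ps) /= /le_lt_trans; exact.
move=> X0 X'0 PP'; apply: joint_law_ext => s.
have [s0|sN0] := boolP (all (fun p => 0 <= p.2) s); last first.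
  exact: etrans (null _ _ _ X s X0 sN0) (esym (null _ _ _ X' s X'0 sN0)).
have cX := @lower_event_right_cvg _ _ _ P _ X s.
have cX' := @lower_event_right_cvg _ _ _ P' _ X' s.
have E : (fun k => P (lower_event (fun i => X i)
      [seq (p.1, p.2 + k.+1%:R^-1) | p <- s])) =
    (fun k => P' (lower_event (fun i => X' i)
      [seq (p.1, p.2 + k.+1%:R^-1) | p <- s])).
  apply/funext => k; apply: PP'; apply/allP => _ /mapP[p ps ->] /=.
  by rewrite ltr_wpDl// (allP s0).
by rewrite E in cX; exact: (cvg_unique _ cX cX').
Qed.

(** * Stieltjes sums and the negative logarithm of the joint distribution function *)

(* The integral of [M] against [df] along the grid [a :: u], for [M] constant on
   each cell and read at the right end of the cell. *)
Fixpoint stieltjes_sum (R : realType) (f M : R -> R) (a : R) (u : seq R) : R :=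
  if u is b :: v then (f b - f a) * M b + stieltjes_sum f M b v else 0.

Lemma stieltjes_sumD (R : realType) (f g M : R -> R) a u :
  stieltjes_sum (fun t => f t + g t) M a u =
  stieltjes_sum f M a u + stieltjes_sum g M a u.
Proof. by elim: u a => [|b u IHu] a /=; rewrite ?addr0// IHu; ring. Qed.

Lemma stieltjes_sum_scale (R : realType) (c : R) (f M : R -> R) a u :
  stieltjes_sum (fun t => c * f t) M a u = c * stieltjes_sum f M a u.
Proof. by elim: u a => [|b u IHu] a /=; rewrite ?mulr0// IHu; ring. Qed.

Lemma eq_stieltjes_sum (R : realType) (f g M N : R -> R) a u :
  f a = g a -> {in u, f =1 g} -> {in u, M =1 N} ->
  stieltjes_sum f M a u = stieltjes_sum g N a u.
Proof.
elim: u a => [|b u IHu] a //= fga fgu MNu.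
rewrite fga fgu ?mem_head// MNu ?mem_head// IHu ?fgu ?mem_head//.
- by move=> x xu; apply: fgu; rewrite in_cons xu orbT.
- by move=> x xu; apply: MNu; rewrite in_cons xu orbT.
Qed.

(** In a sorted grid repeated points are adjacent, so they only create cells of length zero. *)
Lemma stieltjes_sum_undup (R : realType) (M : R -> R) a u :
  sorted <=%R u -> stieltjes_sum id M a (undup u) = stieltjes_sum id M a u.
Proof.
elim: u a => [|b u IHu] a //= bu.
have su := path_sorted bu.
case: ifPn => [|_] /=; last by rewrite IHu.
case: u => [//|c u] in IHu bu su *.
rewrite in_cons => bcu; suff -> : b = c by rewrite IHu//=; ring.
apply/eqP; case/orP: bcu => // bu'; rewrite eq_le; move: bu => /= /andP[-> /=].
by move=> /(order_path_min le_trans)/allP; apply.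
Qed.

Lemma stieltjes_sum_nth (R : realType) (M : R -> R) a u :
  \sum_(i < size u) (nth 0 u i - nth 0 (a :: u) i) * M (nth 0 u i) =
  stieltjes_sum id M a u.
Proof.
by elim: u a => [|b u IHu] a /=; rewrite ?big_ord0// big_ord_recl IHu.
Qed.

(** The increment ending at time [b] enters the maximum at every time [>= b], so it must stay below
    all thresholds set there; the smallest of them has the largest power [- alpha]. The default
    value 0 means no constraint. *)
Definition max_level (R : realType) (alpha : R) (s : seq (R * R)) (b : R) : R :=
  \big[Num.max/0]_(p <- s | b <= p.1) p.2 `^ (- alpha).

(** The first term is the mass that [f] has accumulated at time 0; it is all that remains when [f]
    is constant. The grid consists of the times of [s] and not of their images, which makes the
    expression linear in [f]. *)
Definition neg_log_cdf (R : realType) (alpha : R) (f : R -> R) (s : seq (R * R)) : R :=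
  f 0 * max_level alpha s 0 +
  stieltjes_sum f (max_level alpha s) 0 (sort <=%R [seq p.1 | p <- s]).

Lemma neg_log_cdfD (R : realType) (alpha : R) f g s :
  neg_log_cdf alpha (fun t => f t + g t) s =
  neg_log_cdf alpha f s + neg_log_cdf alpha g s.
Proof. by rewrite /neg_log_cdf stieltjes_sumD; ring. Qed.

Lemma neg_log_cdf_scale (R : realType) (alpha c : R) f s :
  neg_log_cdf alpha (fun t => c * f t) s = c * neg_log_cdf alpha f s.
Proof. by rewrite /neg_log_cdf stieltjes_sum_scale; ring. Qed.

Lemma eq_neg_log_cdf (R : realType) (alpha : R) f g s :
  all (fun p => 0 <= p.1) s -> (forall t, 0 <= t -> f t = g t) ->
  neg_log_cdf alpha f s = neg_log_cdf alpha g s.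
Proof.
move=> /allP s0 fg; rewrite /neg_log_cdf fg//; congr (_ + _).
apply: eq_stieltjes_sum => //; first exact: fg.
by move=> t; rewrite mem_sort => /mapP[p ps ->]; exact/fg/s0.
Qed.

(** Change of variables, cell by cell. Where [f b = f a] both terms vanish; otherwise [f b <= f p.1]
    and [b <= p.1] are equivalent for the times of [s], since by the last hypothesis none of them
    lies strictly between [a] and [b]. *)
Lemma stieltjes_sum_map (R : realType) (alpha : R) (f : R -> R) s a u :
  {in Num.nneg &, {homo f : x y / x <= y}} ->
  0 <= a -> path <=%R a u ->
  all (fun p => 0 <= p.1) s -> {in s, forall p, p.1 <= a \/ p.1 \in u} ->
  stieltjes_sum id (max_level alpha [seq (f p.1, p.2) | p <- s]) (f a) (map f u) =
  stieltjes_sum f (max_level alpha s) a u.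
Proof.
move=> f_nd a0 + /allP s0; elim: u a a0 => [//|b u IHu] a a0 /= /andP[ab bu] sau.
have b0 : 0 <= b by exact: le_trans ab.
rewrite IHu//; last first.
  move=> p ps; have [pa|] := sau p ps; first by left; exact: le_trans ab.
  by rewrite in_cons => /orP[/eqP ->|]; [left|right].
congr (_ + _); have [->|fab] := eqVneq (f b) (f a); first by rewrite subrr !mul0r.
congr (_ * _); rewrite /max_level big_map big_seq_cond [RHS]big_seq_cond.
apply: eq_bigl => p /=; have [ps /=|//] := boolP (p \in s).
have p0 := s0 _ ps; apply/idP/idP => [fbp|]; last exact: f_nd.
rewrite leNgt; apply/negP => pb.
have [pa|] := sau p ps.
  have := le_trans fbp (f_nd _ _ p0 a0 pa).
  by apply/negP; rewrite -ltNge lt_neqAle eq_sym fab f_nd.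
rewrite in_cons => /orP[/eqP pb'|pu]; first by rewrite pb' ltxx in pb.
by have /allP/(_ _ pu) := order_path_min le_trans bu; rewrite leNgt pb.
Qed.

(** * Concavity of powers *)

(** Convexity of the power [beta^-1] at the points [x ^ beta] and [y ^ beta], then both sides raised
    to the power [beta]. *)
Lemma powR_concave (R : realType) (beta t x y : R) :
  0 < beta <= 1 -> 0 <= t <= 1 -> 0 <= x -> 0 <= y ->
  t * x `^ beta + (1 - t) * y `^ beta <= (t * x + (1 - t) * y) `^ beta.
Proof.
move=> /andP[beta0 beta1] /andP[t0 t1] x0 y0.
have beta_neq0 : beta != 0 by rewrite gt_eqF.
have p1 : 1 <= beta^-1 by rewrite invf_ge1.
have nn z : z `^ beta \in (`[0, +oo[%classic : set R).
  by rewrite inE /= in_itv /= andbT powR_ge0.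
have := convex_powR p1 (Itv01 t0 t1) (nn x) (nn y).
rewrite !convRE /= /unstable.onem -!powRrM mulfV// !powRr1//.
have t1' : 0 <= 1 - t by rewrite subr_ge0.
have lhs0 : 0 <= t * x `^ beta + (1 - t) * y `^ beta.
  by rewrite addr_ge0 ?mulr_ge0 ?powR_ge0.
move/(ge0_ler_powR (ltW beta0)) => /=.
rewrite !nnegrE powR_ge0 addr_ge0 ?mulr_ge0// => /(_ isT isT).
by rewrite -powRrM mulVf// powRr1.
Qed.

Lemma powR_increment_le (R : realType) (beta r x y : R) :
  0 < beta <= 1 -> 0 <= r -> 0 <= x -> x <= y ->
  x `^ beta + (y + r) `^ beta <= (x + r) `^ beta + y `^ beta.
Proof.
move=> hbeta r0 x0 xy.
have [yrx|yrx] := leP (y + r) x.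
  have -> : y = x by lra.
  lra.
(* Both [y] and [x + r] are convex combinations of [x] and [y + r]: weight [l] on [x] gives [y],
   weight [1 - l] gives [x + r]. The two concavity inequalities are then added. *)
have [l l01 lE] : exists2 l, 0 <= l <= 1 & l * (y + r - x) = r.
  exists (r / (y + r - x)); last by rewrite divfK// gt_eqF// subr_gt0.
  by rewrite divr_ge0 ?ler_pdivrMr /=; lra.
have yr0 : 0 <= y + r by lra.
have := powR_concave hbeta l01 x0 yr0.
have -> : l * x + (1 - l) * (y + r) = y.
  by transitivity (y + r - l * (y + r - x)); [ring|rewrite lE addrK].
have l01' : 0 <= 1 - l <= 1 by lra.
have := powR_concave hbeta l01' x0 yr0.
have -> : (1 - l) * x + (1 - (1 - l)) * (y + r) = x + r.
  by transitivity (x + l * (y + r - x)); [ring|rewrite lE].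
lra.
Qed.

(** * Fréchet laws *)

(** The scale [h ^ (1 / alpha)] has [alpha]-th power [h]. For [h = 0] the point mass at 0 obeys the
    same formula at positive levels, so later arguments treat both cases at once. *)
Lemma frechet_cdf d (T : measurableType d) (R : realType) (P : probability T R)
    (X : {RV P >-> R}) (alpha h x : R) :
  0 < alpha -> 0 <= h -> has_frechet_law X alpha (h `^ alpha^-1) -> 0 < x ->
  P (X @^-1` `]-oo, x]) = (expR (- (h * x `^ (- alpha))))%:E.
Proof.
move=> alpha0 h0 + x0; rewrite /has_frechet_law powR_eq0 invr_eq0 (gt_eqF alpha0).
rewrite andbT; case: eqP => [-> /(_ `]-oo, x]%classic)|_ /(_ x)].
  rewrite /distribution /pushforward => ->//.
  by rewrite mul0r oppr0 expR0 diracE mem_set//= in_itv/= ltW.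
by rewrite x0 -powRrM mulVf ?gt_eqF// powRr1.
Qed.

Lemma frechet_negative d (T : measurableType d) (R : realType)
    (P : probability T R) (X : {RV P >-> R}) (alpha h : R) :
  has_frechet_law X alpha h -> P (X @^-1` `]-oo, 0[) = 0%E.
Proof.
rewrite /has_frechet_law; case: eqP => [_ /(_ `]-oo, 0[%classic)|_ /(_ 0)].
  rewrite /distribution /pushforward => ->//.
  by rewrite diracE memNset//= in_itv/= ltxx.
rewrite ltxx => X0; apply/eqP; rewrite eq_le measure_ge0 andbT.
suff : (P (X @^-1` `]-oo, 0%R[) <= cdf X 0%R)%E by rewrite X0.
apply: le_measure; rewrite ?inE; [exact: measurable_funPTI..|].
by move=> w /=; rewrite !in_itv; exact: ltW.
Qed.

Lemma frechet_lower_event d (T : measurableType d) (R : realType)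
    (P : probability T R) (X : {RV P >-> R}) (alpha h : R) (s : seq (R * R)) :
  0 < alpha -> 0 <= h -> has_frechet_law X alpha (h `^ alpha^-1) ->
  all (fun p => 0 < p.2) s ->
  P (lower_event (fun=> X) s) =
  (expR (- (h * \big[Num.max/0]_(p <- s) p.2 `^ (- alpha))))%:E.
Proof.
move=> alpha0 h0 hX s0.
(* Either there is no constraint, or all constraints amount to the one with the smallest threshold
   [x]. *)
suff [[-> ->]|[x x0 [-> ->]]] :
    (lower_event (fun=> X) s = setT /\
       \big[Num.max/0]_(p <- s) p.2 `^ (- alpha) = 0) \/
    exists2 x, 0 < x & lower_event (fun=> X) s = X @^-1` `]-oo, x] /\
      \big[Num.max/0]_(p <- s) p.2 `^ (- alpha) = x `^ (- alpha).
- by rewrite probability_setT mulr0 oppr0 expR0.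
- exact: frechet_cdf.
have mono (x y : R) : 0 < x -> x <= y -> y `^ (- alpha) <= x `^ (- alpha).
  move=> x0 xy; have y0 := lt_le_trans x0 xy.
  rewrite !powRN lef_pV2 ?posrE ?powR_gt0//.
  by apply: ge0_ler_powR => //; rewrite ?nnegrE; exact: ltW.
elim: s s0 => [_|p s IHs /= /andP[p0 /IHs {}IHs]].
  left; split; last by rewrite big_nil.
  by apply/seteqP; split.
right; rewrite lower_event_cons big_cons.
case: IHs => [[-> ->]|[x x0 [-> ->]]].
  by exists p.2 => //; rewrite setIT max_l ?powR_ge0.
have [px|xp] := leP p.2 x.
  exists p.2 => //; rewrite max_l ?mono//; split => //.
  by rewrite setIidl// => w /=; rewrite !in_itv/= => /le_trans; exact.
exists x => //; rewrite max_r ?mono ?ltW//; split => //.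
by rewrite setIidr// => w /=; rewrite !in_itv/= => /le_trans; apply; exact: ltW.
Qed.

(** * Finite-dimensional distributions of the extremal process *)

Lemma measurable_ltr_set d (T : measurableType d) (R : realType) (f g : T -> R) :
  measurable_fun [set: T] f -> measurable_fun [set: T] g ->
  measurable [set w | f w < g w].
Proof.
move=> mf mg.
have /(_ measurableT [set true] I) := measurable_fun_ltr mf mg.
by rewrite setTI.
Qed.

Section extremal_frechet.
Context d (T : measurableType d) (R : realType) (P : probability T R).
Variables (alpha : R) (Z : R -> {RV P >-> R}).
Hypotheses (alpha0 : 0 < alpha) (hZ : extremal_frechet alpha Z).

Lemma extremal_frechet_ge0 t : 0 <= t -> P [set w | Z t w < 0] = 0%E.
Proof.
move=> t0.
have [//|d' [T' [Q [X [_ /(_ ord0)/= hX]]]]] := hZ (n := 0) (t := fun=> t) t0.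
pose B : set (1.-tuple R) := (fun z => tnth z ord0) @^-1` `]-oo, 0[.
have mB : measurable B.
  by rewrite -[B]setTI; exact: measurable_tnth.
move=> /(_ B mB) ZX; rewrite -(frechet_negative hX).
transitivity (joint_law P (fun i : 'I_1 => Z t) B).
  by congr (P _); apply/seteqP; split=> w /=; rewrite /B /= tnth_mktuple in_itv.
rewrite ZX; congr (Q _).
have max1 w : \big[Num.max/X ord0 w]_(j < 1 | (j <= 0)%N) X j w = X ord0 w.
  apply/eqP; rewrite eq_le bigmax_ge_id andbT; apply/bigmax_leP.
  by split=> // j _; rewrite (ord1 j).
by apply/seteqP; split=> w /=; rewrite /B /= tnth_mktuple max1.
Qed.

Lemma time_increment_ge0 (u : seq R) k : sorted <%R u -> all (>= 0) u ->
  (k < size u)%N -> 0 <= time_increment (nth 0 u) k.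
Proof.
case: k => [|k] su /allP u0 ku /=; first exact/u0/mem_nth.
by rewrite subr_ge0 ltW//; move/(sortedP 0): su; apply.
Qed.

(** All partial maxima obey their thresholds exactly when each [X j] is below every threshold set at
    a time [>= u_j]. By independence the probability is a product of Fréchet factors, one per cell
    of the grid. *)
Lemma extremal_frechet_grid (u : seq R) (s : seq (R * R)) :
  sorted <%R u -> all (>= 0) u ->
  all (fun p => 0 < p.2) s -> {in s, forall p, p.1 \in u} ->
  P (lower_event (fun t => Z t) s) =
  (expR (- stieltjes_sum id (max_level alpha s) 0 u))%:E.
Proof.
move=> su u0 s0 s_u.
(* The definition of the process speaks of [n.+1] times, so the empty grid is treated apart. *)
have [uE|[n un]] : u = [::] \/ exists n, size u = n.+1.
  by case: (u) => [|? v]; [left|right; exists (size v)].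
  have -> : s = [::] by case: (s) s_u => // p s' /(_ p (mem_head _ _)); rewrite uE.
  rewrite uE /= oppr0 expR0 -[RHS](probability_setT P); congr (P _).
  by apply/seteqP; split.
have t00 : 0 <= nth 0 u 0 by apply: (allP u0); rewrite mem_nth// un.
have [k kn|d' [T' [Q [X [indep hX ZX]]]]] := hZ (n := n) t00.
  by move/(sortedP 0): su; apply; rewrite un.
pose rank (p : R * R) : 'I_n.+1 := inord (index p.1 u).
have rankE p : p \in s -> rank p = index p.1 u :> nat.
  by move=> /s_u pu; rewrite inordK// -un index_mem.
have nth_rank p : p \in s -> nth 0 u (rank p) = p.1.
  by move=> ps; rewrite rankE// nth_index// s_u.
pose B := lower_orthant [seq (rank p, p.2) | p <- s].
transitivity (joint_law P (fun i : 'I_n.+1 => Z (nth 0 u i)) B).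
  congr (P _); apply/seteqP; split=> w /=; rewrite /B /lower_orthant /lower_event /=;
    rewrite all_map => /allP sw; apply/allP => p ps; have := sw p ps.
    by rewrite /= tnth_mktuple nth_rank.
  by rewrite /= tnth_mktuple nth_rank.
rewrite ZX; last exact: measurable_lower_orthant.
(* The constraints that bear on the increment [X j]. *)
pose A (j : nat) : set R :=
  lower_event (fun=> id) [seq p <- s | nth 0 u j <= p.1].
have mA j : measurable (A j) by exact: measurable_lower_event.
transitivity (Q (\bigcap_(j in [set: 'I_n.+1]) (X j @^-1` A j))).
  congr (Q _); apply/seteqP; split => w.
    rewrite /B /lower_orthant /lower_event /= all_map => /allP sw j _.
    apply/allP => p; rewrite mem_filter => /andP[jp ps]; have := sw p ps.
    rewrite /= tnth_mktuple => /bigmax_leP [_]; apply.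
    by move: jp; rewrite -(nth_rank p ps) lt_sorted_leq_nth ?inE ?un.
  move=> Aw; rewrite /B /lower_orthant /lower_event /= all_map; apply/allP => p ps /=.
  rewrite tnth_mktuple; have XA (j : 'I_n.+1) : (j <= rank p)%N -> X j w <= p.2.
    move=> jp; have /allP := Aw j I; apply.
    by rewrite mem_filter ps -(nth_rank p ps) lt_sorted_leq_nth ?inE ?un ?jp.
  by apply/bigmax_leP; split => [|j]; exact: XA.
rewrite indep//.
under eq_bigr => j _.
  rewrite (frechet_lower_event alpha0 _ (hX j)) ?time_increment_ge0 ?un//; last first.
    by apply/allP => p; rewrite mem_filter => /andP[_ ps]; exact: (allP s0 p ps).
  over.
rewrite prodEFin -expR_sum sumrN; congr (expR (- _))%:E.
(* The first increment is [u_0 - 0], which is why the sum starts from [a = 0]. *)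
rewrite -stieltjes_sum_nth un; apply: eq_bigr => -[[|k] kn] _.
  by rewrite big_filter /= subr0.
by rewrite big_filter.
Qed.

(** The grid formula is applied to the images under [f] of 0 and of the times of [s]. They must be
    made distinct first, as [f] may be constant on intervals; the cell from 0 to [f 0] yields the
    first term of [neg_log_cdf]. *)
Lemma extremal_frechet_time_change (f : R -> R) (s : seq (R * R)) :
  {in Num.nneg &, {homo f : x y / x <= y}} -> (forall t, 0 <= t -> 0 <= f t) ->
  all (fun p => 0 <= p.1) s -> all (fun p => 0 < p.2) s ->
  P (lower_event (fun t => Z (f t)) s) = (expR (- neg_log_cdf alpha f s))%:E.
Proof.
move=> f_nd f0 s1 s2.
pose u := sort <=%R [seq p.1 | p <- s].
have u0 t : t \in u -> 0 <= t.
  by rewrite mem_sort => /mapP[p ps ->]; exact: (allP s1).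
have su : path <=%R 0 u.
  rewrite path_sortedE; last exact: le_trans.
  by rewrite sort_sorted ?andbT; [exact/allP|exact: le_total].
have fu : sorted <=%R (map f (0 :: u)).
  rewrite /= path_map; apply: (sub_in_path (P := >= 0)) su => [x y|].
    exact: f_nd.
  by rewrite /= lexx; apply/allP => t; exact: u0.
pose v := undup (map f (0 :: u)).
have -> : lower_event (fun t => Z (f t)) s =
    lower_event (fun t => Z t) [seq (f p.1, p.2) | p <- s].
  exact: (lower_event_reindex (fun t => Z t)).
rewrite (@extremal_frechet_grid v).
- rewrite stieltjes_sum_undup//= /neg_log_cdf subr0 stieltjes_sum_map//.
    suff -> : max_level alpha [seq (f p.1, p.2) | p <- s] (f 0) =
        max_level alpha s 0 by [].
    rewrite /max_level big_map big_seq_cond [RHS]big_seq_cond.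
    apply: eq_bigl => p /=; have [ps /=|//] := boolP (p \in s).
    by rewrite (allP s1)// f_nd ?nnegrE// (allP s1).
  by move=> p ps; right; rewrite mem_sort map_f.
- rewrite lt_sorted_uniq_le undup_uniq /=.
  by apply: (subseq_sorted le_trans _ fu); exact: undup_subseq.
- apply/allP => y; rewrite mem_undup => /mapP[t tu ->]; apply: f0.
  by move: tu; rewrite in_cons => /orP[/eqP->//|]; exact: u0.
- by rewrite all_map.
- move=> _ /mapP[p ps ->]; rewrite mem_undup /= in_cons map_f ?orbT//.
  by rewrite mem_sort map_f.
Qed.

(** The law at two times is that of a pair of successive maxima, which gives mass zero to the
    measurable set of decreasing pairs. *)
Lemma extremal_frechet_nondecreasing a b :
  0 <= a -> a <= b -> {ae P, forall w, Z a w <= Z b w}.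
Proof.
move=> a0; rewrite le_eqVlt => /orP[/eqP ->|ab]; first exact: aeW.
pose t k := if k is 0%N then a else b.
have [[|//] _|d' [T' [Q [X [_ _ ZX]]]]] := hZ (n := 1) (t := t) a0; first exact: ab.
pose B : set (2.-tuple R) := [set z | tnth z ord_max < tnth z ord0].
have mB : measurable B.
  by apply: measurable_ltr_set; exact: measurable_tnth.
have ZB : P [set w | Z b w < Z a w] = joint_law P (fun i : 'I_2 => Z (t i)) B.
  by congr (P _); apply/seteqP; split=> w; rewrite /B /= !tnth_mktuple.
rewrite ZX// in ZB.
exists [set w | Z b w < Z a w]; split.
- exact: measurable_ltr_set.
- rewrite ZB -(measure0 Q); congr (Q _); apply/seteqP; split => // w.
  rewrite /B /= !tnth_mktuple ltNge => /negP; apply.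
  apply/bigmax_leP; split=> [|j _]; first exact: bigmax_ge_id.
  by apply: le_bigmax_cond; rewrite -ltnS ltn_ord.
- by move=> w /= /negP; rewrite -ltNge.
Qed.

End extremal_frechet.

(** * Rescaling the thresholds *)

Lemma stieltjes_sum_scale_integrand (R : realType) (c : R) (f M : R -> R) a u :
  stieltjes_sum f (fun t => c * M t) a u = c * stieltjes_sum f M a u.
Proof. by elim: u a => [|b u IHu] a /=; rewrite ?mulr0// IHu; ring. Qed.

Lemma max_level_scale (R : realType) (alpha k : R) s b :
  0 <= k -> all (fun p => 0 <= p.2) s ->
  max_level alpha [seq (p.1, k * p.2) | p <- s] b =
  k `^ (- alpha) * max_level alpha s b.
Proof.
move=> k0 s0; rewrite /max_level big_map /=.
rewrite (big_morph _ (id1 := 0) (op1 := Num.max)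
  (fun x y => maxr_pMr x y (powR_ge0 k (- alpha))) (mulr0 _)).
rewrite big_seq_cond [RHS]big_seq_cond; apply: eq_bigr => p /andP[ps _].
by rewrite powRM// (allP s0).
Qed.

Lemma neg_log_cdf_scale_level (R : realType) (alpha k : R) f s :
  0 <= k -> all (fun p => 0 <= p.2) s ->
  neg_log_cdf alpha f [seq (p.1, k * p.2) | p <- s] =
  k `^ (- alpha) * neg_log_cdf alpha f s.
Proof.
move=> k0 s0; rewrite /neg_log_cdf max_level_scale// -map_comp mulrDr.
congr (_ + _); first by rewrite mulrCA.
rewrite -stieltjes_sum_scale_integrand; apply: eq_stieltjes_sum => // b _.
exact: max_level_scale.
Qed.

(** * Product space, home of the independent copy *)

Section product_probability.
Context d1 d2 (T1 : measurableType d1) (T2 : measurableType d2) (R : realType).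
Variables (P1 : probability T1 R) (P2 : probability T2 R).

Definition product_probability : set (T1 * T2) -> \bar R := (P1 \x P2)%E.

HB.instance Definition _ := Measure.on product_probability.

Lemma product_probabilityE A B : measurable A -> measurable B ->
  product_probability (A `*` B) = (P1 A * P2 B)%E.
Proof. exact: product_measure1E. Qed.

Lemma product_probability_setT : product_probability [set: _] = 1%E.
Proof. by rewrite -setXTT product_probabilityE// !probability_setT mule1. Qed.

HB.instance Definition _ := Measure_isProbability.Build _ _ _
  product_probability product_probability_setT.

End product_probability.

Definition RV_of d (T : measurableType d) (R : realType) (P : probability T R)
    (f : T -> R) (mf : measurable_fun [set: T] f) : {RV P >-> R} :=
  HB.pack f (isMeasurableFun.Build _ _ _ _ f mf).

Lemma measure_setI_ae d (T : measurableType d) (R : realType)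
    (P : probability T R) (A B : set T) :
  measurable A -> measurable B -> {ae P, forall w, A w -> B w} ->
  P (A `&` B) = P A.
Proof.
move=> mA mB [N [mN N0 AN]]; rewrite [RHS](measureDI _ mA mB).
rewrite (@subset_measure0 _ _ _ P (A `\` B) N) ?add0e//; first exact: measurableD.
by move=> w [Aw nBw]; apply: AN => /(_ Aw).
Qed.

(** * The time-changed process *)

Section subfractional_time_change.
Context d (T : measurableType d) (R : realType) (P : probability T R).
Variables (alpha beta : R) (Z : R -> {RV P >-> R}).
Hypotheses (alpha0 : 0 < alpha) (beta01 : 0 < beta <= 1).
Hypothesis hZ : extremal_frechet alpha Z.

Let beta0 : 0 < beta. Proof. by case/andP: beta01. Qed.

Lemma powR_nondecreasing :
  {in Num.nneg &, {homo (fun t : R => t `^ beta) : x y / x <= y}}.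
Proof. exact/ge0_ler_powR/ltW. Qed.

(** Scaling time by [c] multiplies the negative logarithm by [c ^ beta]; dividing the levels by
    [k = c ^ (beta / alpha)] multiplies it by [k ^ alpha], the same factor. *)
Lemma time_changed_self_similar :
  self_similar (beta / alpha) (fun t => Z (t `^ beta)).
Proof.
move=> c c0 n t t0.
pose k := c `^ (beta / alpha).
have k0 : 0 < k by rewrite powR_gt0.
have mX i : measurable_fun [set: T] (fun w => k * Z (t i `^ beta) w).
  by apply: measurable_funM.
apply: (joint_law_ext_ge0 (X := fun i => Z ((c * t i) `^ beta))
  (X' := fun i => RV_of P (mX i))).
- by move=> i; apply: extremal_frechet_ge0 hZ _ _; rewrite powR_ge0.
- move=> i /=; rewrite -(extremal_frechet_ge0 hZ (powR_ge0 (t i) beta)).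
  by congr (P _); apply/seteqP; split => w /=; rewrite pmulr_rlt0.
move=> s s0.
pose s1 := [seq (t p.1, p.2) | p <- s].
have s1_time : all (fun p => 0 <= p.1) s1.
  by apply/allP => _ /mapP[p ps ->] /=.
have s1_level : all (fun p => 0 < p.2) s1 by rewrite all_map.
rewrite (lower_event_reindex (fun x => Z ((c * x) `^ beta)) t) -/s1.
have -> : lower_event (fun i => RV_of P (mX i)) s =
    lower_event (fun x => Z (x `^ beta)) [seq (p.1, k^-1 * p.2) | p <- s1].
  apply/seteqP; rewrite -map_comp.
  by split => w; rewrite /lower_event /= all_map => /allP sw;
    apply/allP => p /sw /=; rewrite ler_pdivlMl.
rewrite !(extremal_frechet_time_change alpha0 hZ)//.
- suff -> : neg_log_cdf alpha (fun x => (c * x) `^ beta) s1 =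
    neg_log_cdf alpha (fun x => x `^ beta) [seq (p.1, k^-1 * p.2) | p <- s1] by [].
  rewrite neg_log_cdf_scale_level ?invr_ge0 ?(ltW k0)//; last first.
    by apply/allP => p /(allP s1_level)/ltW.
  rewrite -neg_log_cdf_scale; apply: eq_neg_log_cdf => // x x0.
  rewrite powRM ?(ltW c0)//; congr (_ * _).
  rewrite -powR_inv1 ?(ltW k0)// -powRrM mulN1r opprK /k -powRrM.
  by rewrite divfK// gt_eqF.
- move=> x y x0 y0 xy.
  apply: powR_nondecreasing; rewrite ?nnegrE ?mulr_ge0 ?(ltW c0)//.
  by rewrite ler_pM2l.
- by move=> x _; exact: powR_ge0.
- exact: powR_nondecreasing.
- by move=> x _; exact: powR_ge0.
- by rewrite all_map; apply/allP => p /(allP s1_time).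
- rewrite all_map; apply/allP => p /(allP s1_level) /= p0.
  by rewrite mulr_gt0 ?invr_gt0.
Qed.

Lemma measurable_maxr_prod a b :
  measurable_fun [set: T * T] (fun w => Num.max (Z a w.1) (Z b w.2)).
Proof.
by apply: (measurable_maxr (f := Z a \o fst) (g := Z b \o snd));
  apply: measurableT_comp.
Qed.

Lemma measurable_lower_event_Z (f : R -> R) (s : seq (R * R)) :
  measurable (lower_event (fun t => Z (f t)) s).
Proof. exact: measurable_lower_event. Qed.

(** Almost sure monotonicity, used once for each of the finitely many constraints. *)
Lemma extremal_frechet_ae_le (f : R -> R) b s :
  (forall t, 0 <= t -> 0 <= f t) -> (forall t, 0 <= t -> f t <= b) ->
  all (fun q => 0 <= q.1) s ->
  {ae P, forall w, lower_event (fun=> Z b) s w -> lower_event (fun t => Z (f t)) s w}.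
Proof.
move=> f0 fb; elim: s => [_|q s IHs /= /andP[q0 /IHs]]; first exact: aeW.
have := extremal_frechet_nondecreasing hZ (f0 _ q0) (fb _ q0).
apply: filterS2 => w Zq Zs; rewrite !lower_event_cons => -[/= + /Zs sw].
by rewrite in_itv /= => Zb; split => //=; rewrite in_itv /= (le_trans Zq).
Qed.

Lemma time_changed_stationary_max_increments :
  stationary_max_increments (fun t => Z (t `^ beta)).
Proof.
move=> r r0.
pose rho t := t `^ beta + r `^ beta - (t + r) `^ beta.
pose delta t := (t + r) `^ beta - r `^ beta.
have rho_nd : {in Num.nneg &, {homo rho : x y / x <= y}}.
  move=> x y; rewrite !nnegrE => x0 y0 xy.
  by have := powR_increment_le beta01 r0 x0 xy; rewrite /rho; lra.
(* Subadditivity of the power, as the increment inequality started at [x = 0]. *)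
have rho0 t : 0 <= t -> 0 <= rho t.
  move=> t0; have := powR_increment_le beta01 r0 (lexx 0) t0.
  by rewrite /rho powR0 ?gt_eqF// !add0r; lra.
have delta_nd : {in Num.nneg &, {homo delta : x y / x <= y}}.
  move=> x y; rewrite !nnegrE => x0 y0 xy; rewrite lerD2r.
  by apply: powR_nondecreasing; rewrite ?nnegrE ?addr_ge0// lerD2r.
have delta0 t : 0 <= t -> 0 <= delta t.
  move=> t0; rewrite subr_ge0.
  by apply: powR_nondecreasing; rewrite ?nnegrE ?addr_ge0// lerDr.
have rho_le t : 0 <= t -> rho t <= r `^ beta.
  move=> t0; suff : t `^ beta <= (t + r) `^ beta by rewrite /rho; lra.
  by apply: powR_nondecreasing; rewrite ?nnegrE ?addr_ge0// lerDl.
pose P' := product_probability P P.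
pose Yr t : {RV P' >-> R} := RV_of P' (measurable_maxr_prod (rho t) (delta t)).
(* A maximum is below a threshold when both terms are, so the event is a rectangle and its
   probability a product. *)
have Yr_lower s : lower_event (fun t => Yr t) s =
    lower_event (fun t => Z (rho t)) s `*` lower_event (fun t => Z (delta t)) s.
  apply/seteqP; split => [w /allP sw|w [/allP sw1 /allP sw2]].
    by split; apply/allP => p /sw /=; rewrite ge_max => /andP[].
  by apply/allP => p ps /=; rewrite ge_max sw1//= sw2.
have Yr_ge0 t : 0 <= t -> P' [set w | Yr t w < 0] = 0%E.
  move=> t0; rewrite (_ : [set w | _] =
    [set w | Z (rho t) w < 0] `*` [set w | Z (delta t) w < 0]).
    rewrite /P' /= product_probabilityE ?(extremal_frechet_ge0 hZ (rho0 t t0)) ?mul0e//.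
    - by apply: measurable_ltr_set.
    - by apply: measurable_ltr_set.
  by apply/seteqP; split => w /=; rewrite gt_max => /andP.
have mfst : measurable_fun [set: T * T] (@fst T T) by [].
(* The original process lives on the first factor. [Yr] uses that same factor at the times [rho t]
   and the independent copy at the times [delta t]. *)
pose p : {mfun (T * T)%type >-> T} :=
  HB.pack (@fst T T) (isMeasurableFun.Build _ _ _ _ _ mfst).
exists _, (T * T)%type, P', p, Yr; split.
- move=> A mA; rewrite /distribution /pushforward /=.
  rewrite (_ : _ @^-1` A = A `*` setT); last first.
    by apply/seteqP; split => w //= [].
  by rewrite /P' /= product_probabilityE// probability_setT mule1.
- move=> n t t0.
  apply: (joint_law_ext_ge0 (X := fun i => Yr (t i))
    (X' := fun i => Z (t i `^ beta))) => [i|i|s s0].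
  + exact: Yr_ge0.
  + by rewrite (extremal_frechet_ge0 hZ)// powR_ge0.
  pose s1 := [seq (t q.1, q.2) | q <- s].
  have s1_time : all (fun q => 0 <= q.1) s1 by rewrite all_map; apply/allP => q _ /=.
  have s1_level : all (fun q => 0 < q.2) s1 by rewrite all_map.
  rewrite (lower_event_reindex (fun x => Yr x) t) -/s1 Yr_lower.
  rewrite (lower_event_reindex (fun x => Z (x `^ beta)) t) -/s1.
  rewrite /P' /= product_probabilityE; [|exact: measurable_lower_event_Z..].
  rewrite (extremal_frechet_time_change alpha0 hZ rho_nd rho0 s1_time s1_level).
  rewrite (extremal_frechet_time_change alpha0 hZ delta_nd delta0 s1_time s1_level).
  rewrite (extremal_frechet_time_change alpha0 hZ powR_nondecreasing
    (fun x _ => powR_ge0 x beta) s1_time s1_level).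
  rewrite -EFinM -expRD -opprD -neg_log_cdfD.
  suff -> : neg_log_cdf alpha (fun x => rho x + delta x) s1 =
    neg_log_cdf alpha (fun x => x `^ beta) s1 by [].
  by apply: eq_neg_log_cdf => // x _; rewrite /rho /delta; ring.
- move=> n t t0.
  have mX i : measurable_fun [set: T * T]
      (fun w => Num.max (Z (r `^ beta) (p w)) (Yr (t i) w)).
    apply: (measurable_maxr (f := Z (r `^ beta) \o fst) (g := Yr (t i))) => //.
    exact: measurableT_comp.
  apply: (joint_law_ext_ge0 (X := fun i => Z ((t i + r) `^ beta))
    (X' := fun i => RV_of P' (mX i))) => [i|i|s s0].
  + by rewrite (extremal_frechet_ge0 hZ)// powR_ge0.
  (* If the maximum is negative, so is [Yr]. *)
  + apply: (@subset_measure0 _ _ _ P' _ [set w | Yr (t i) w < 0]).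
    * by apply: measurable_ltr_set.
    * by apply: measurable_ltr_set.
    * by move=> w /=; rewrite gt_max => /andP[].
    * exact: Yr_ge0.
  pose s1 := [seq (t q.1, q.2) | q <- s].
  have s1_time : all (fun q => 0 <= q.1) s1 by rewrite all_map; apply/allP => q _ /=.
  have s1_level : all (fun q => 0 < q.2) s1 by rewrite all_map.
  rewrite (lower_event_reindex (fun x => Z ((x + r) `^ beta)) t) -/s1.
  have -> : lower_event (fun i => RV_of P' (mX i)) s =
      (lower_event (fun=> Z (r `^ beta)) s1 `&` lower_event (fun x => Z (rho x)) s1)
      `*` lower_event (fun x => Z (delta x)) s1.
    rewrite /lower_event; apply/seteqP; split => w /=; rewrite !all_map.
      by move=> /allP sw; split; [split|]; apply/allP => q /sw /=;
        rewrite !ge_max => /and3P[].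
    move=> [[/allP sw0 /allP sw1] /allP sw2]; apply/allP => q qs.
    by have /= := (sw0 q qs, sw1 q qs, sw2 q qs); rewrite !ge_max => -[[-> ->] ->].
  have mE1 := measurable_lower_event_Z (fun=> r `^ beta) s1.
  have mE2 := measurable_lower_event_Z rho s1.
  have mE3 := measurable_lower_event_Z delta s1.
  rewrite /P' /= product_probabilityE//; last exact: measurableI.
  (* The constraints on [Z (rho t)] follow almost surely from those on [Z (r ^ beta)] and drop
     out. *)
  have rhoZ := extremal_frechet_ae_le rho0 rho_le s1_time.
  rewrite (measure_setI_ae mE1 mE2 rhoZ).
  (* The single variable [Z (r ^ beta)] is treated as a constant time change, so that additivity
     applies to [r ^ beta + delta]. *)
  have r_nd : {in Num.nneg &, {homo (fun _ : R => r `^ beta) : x y / x <= y}}.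
    by move=> x y x0 y0 xy; exact: lexx.
  rewrite (extremal_frechet_time_change alpha0 hZ r_nd
    (fun _ _ => powR_ge0 _ _) s1_time s1_level).
  rewrite (extremal_frechet_time_change alpha0 hZ delta_nd delta0 s1_time s1_level).
  have shift_nd :
      {in Num.nneg &, {homo (fun x => (x + r) `^ beta) : x y / x <= y}}.
    move=> x y; rewrite !nnegrE => x0 y0 xy.
    by apply: powR_nondecreasing; rewrite ?nnegrE ?addr_ge0// lerD2r.
  rewrite (extremal_frechet_time_change alpha0 hZ shift_nd
    (fun _ _ => powR_ge0 _ _) s1_time s1_level).
  rewrite -EFinM -expRD -opprD -neg_log_cdfD.
  suff -> : neg_log_cdf alpha (fun x => r `^ beta + delta x) s1 =
    neg_log_cdf alpha (fun x => (x + r) `^ beta) s1 by [].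
  by apply: eq_neg_log_cdf => // x _; rewrite /delta; ring.
Qed.

End subfractional_time_change.

Theorem proposition3p5 (R : realType) (d : measure_display)
    (T : measurableType d) (P : probability T R) (alpha beta : R)
    (Z : R -> {RV P >-> R}) (halpha : 0 < alpha) (hbeta0 : 0 < beta)
    (hbeta1 : beta < 1) (hZ : extremal_frechet alpha Z) :
  self_similar (beta / alpha) (fun t : R => Z (t `^ beta)) /\
  stationary_max_increments (fun t : R => Z (t `^ beta)).
Proof.
have beta01 : 0 < beta <= 1 by rewrite hbeta0 ltW.
split; first exact: time_changed_self_similar.
exact: (time_changed_stationary_max_increments halpha beta01).
Qed.
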